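(* Let $\lambda$ be a nonzero real parameter and $x$ a variable. For all integers $n,k\ge 0$, \[ \sum_{m=0}^{n}\frac{1}{k!}\,\Delta^k x^m\,\lambda^{n-m}S_1(n,m)=\begin{cases} S_{2,\lambda}(n,k\mid x), & \text{if } n\ge k,\\ 0, & \text{if } n<k.\end{cases} \]
   Context: $S_1(n,m)$ denotes the (signed) Stirling numbers of the first kind, defined by $(x)_n=x(x-1)\cdots(x-n+1)=\sum_{m=0}^n S_1(n,m)x^m$ (with $(x)_0=1$). $\Delta$ is the forward difference operator $\Delta f(x)=f(x+1)-f(x)$, so $\Delta^k f(x)=\sum_{l=0}^k\binom{k}{l}(-1)^{k-l}f(x+l)$; here $\Delta^k x^m$ means $\Delta^k$ applied to the function $x\mapsto x^m$, evaluated at $x$. The degenerate Stirling polynomials of the second kind $S_{2,\lambda}(n,k\mid x)$ are defined by \[ \frac{1}{k!}(1+\lambda t)^{x/\lambda}\big((1+\lambda t)^{1/\lambda}-1\big)^k=\sum_{n=k}^{\infty}S_{2,\lambda}(n,k\mid x)\frac{t^n}{n!}. \] *)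

(* Defs.v *)
From mathcomp Require Import all_boot all_order all_algebra.
From mathcomp Require Import all_classical all_reals all_analysis.
Set Implicit Arguments.
Unset Strict Implicit.
Unset Printing Implicit Defensive.
Import Order.TTheory GRing.Theory Num.Theory.
Import numFieldNormedType.Exports.
Local Open Scope classical_set_scope.
Local Open Scope ring_scope.

Definition falling_poly (n : nat) : {poly int} :=
  \prod_(i < n) ('X - (i%:Z)%:P).

Definition stirling1 (n m : nat) : int := (falling_poly n)`_m.

Definition fdiff (R : realType) (f : R -> R) : R -> R :=
  fun x => f (x + 1) - f x.

Definition dstirling2_gf (R : realType) (lambda : R) (k : nat) (x t : R) : R :=
  (k`!%:R)^-1 * (1 + lambda * t) `^ (x / lambda) *
  ((1 + lambda * t) `^ (lambda^-1) - 1) ^+ k.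

(* [a] is a coefficient sequence of the expansion
     dstirling2_gf lambda k x t = \sum_(n >= k) a n * t ^ n / n!
   for t near 0. The values a n with n < k are left unconstrained. *)
Definition dstirling2_expansion (R : realType) (lambda : R) (k : nat) (x : R)
    (a : nat -> R) : Prop :=
  \forall t \near (0 : R),
    (fun N : nat => \sum_(k <= n < N) a n * (t ^+ n / n`!%:R)) @ \oo
      --> dstirling2_gf lambda k x t.

(* S_{2,lambda}(n, k | x), read off a chosen expansion: its coefficients are
   unique for n >= k, and the value is meaningless for n < k. *)
Definition dstirling2 (R : realType) (lambda : R) (n k : nat) (x : R) : R :=
  xget (fun=> 0) [set a : nat -> R | dstirling2_expansion lambda k x a] n.

(* Main.v *)
(* The coefficients of y (y - lambda) ... (y - (n-1) lambda) as a polynomial in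
   y are lambda^(n-m) S_1(n,m), so the left-hand side is 1/k! Delta^k of this
   degenerate falling factorial at x.
   By the binomial series, the factorial is also the coefficient of t^n / n!
   in (1 + lambda t)^(y / lambda).  As a function of y the latter is geometric, so
   Delta^k multiplies it by ((1 + lambda t)^(1 / lambda) - 1)^k, which yields
   the generating function.  For n < k the falling factorial is a polynomial of
   degree below k and Delta^k kills it; for n >= k one concludes by uniqueness
   of power series coefficients. *)
Require Import Defs.
From mathcomp Require Import all_boot all_order all_algebra.
From mathcomp Require Import all_classical all_reals all_analysis.
From mathcomp Require Import ring lra.
Set Implicit Arguments.
Unset Strict Implicit.
Unset Printing Implicit Defensive.
Import Order.TTheory GRing.Theory Num.Theory.
Import numFieldNormedType.Exports.
Local Open Scope classical_set_scope.
Local Open Scope ring_scope.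

(** * Iterated forward differences *)

Lemma iter_fdiff_sum (R : realType) (I : Type) (r : seq I) (c : I -> R)
    (f : I -> R -> R) k x :
  iter k (@fdiff R) (fun y => \sum_(i <- r) c i * f i y) x =
  \sum_(i <- r) c i * iter k (@fdiff R) (f i) x.
Proof.
elim: k x => [//|k IH] x; rewrite iterS /fdiff !IH -sumrB.
by apply: eq_bigr => i _; rewrite -mulrBr.
Qed.

(** Induction on [k], peeling off the innermost difference: by the binomial theorem it turns
    [y ^+ m] into a combination of powers below [m]. *)
Lemma iter_fdiff_exp_eq0 (R : realType) k m (x : R) : (m < k)%N ->
  iter k (@fdiff R) (fun y => y ^+ m) x = 0.
Proof.
elim: k m => [//|k IH] m mk; rewrite iterSr.
have -> : fdiff (fun y : R => y ^+ m) =
    fun y => \sum_(i < m) ('C(m, i)%:R : R) * y ^+ i.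
  apply/funext => y; rewrite /fdiff exprD1n.
  rewrite big_ord_recr/= binn mulr1n addrK.
  by apply: eq_bigr => i _; rewrite mulr_natl.
rewrite iter_fdiff_sum big1// => i _.
by rewrite IH ?mulr0// (leq_trans (ltn_ord i)).
Qed.

Lemma iter_fdiff_powR (R : realType) (lambda a : R) k x : 0 < a ->
  iter k (@fdiff R) (fun y => a `^ (y / lambda)) x =
  a `^ (x / lambda) * (a `^ lambda^-1 - 1) ^+ k.
Proof.
move=> a0; elim: k x => [|k IH] x; first by rewrite mulr1.
rewrite iterS /fdiff !IH mulrDl mul1r powRD; last first.
  by rewrite (gt_eqF a0) implybT.
by rewrite exprS; ring.
Qed.

(** The neighbourhood of 0 in the hypothesis may depend on [y]. The iterated difference at [x] only
    evaluates at [x], ..., [x + k], so finitely many neighbourhoods are intersected. *)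
Lemma cvg_iter_fdiff (R : realType) (F : R -> nat -> R -> R) (G : R -> R -> R)
    k x :
  (forall y, \forall t \near (0 : R), F t ^~ y @ \oo --> G t y) ->
  \forall t \near (0 : R),
    (fun N => iter k (@fdiff R) (F t N) x) @ \oo --> iter k (@fdiff R) (G t) x.
Proof.
move=> FG; elim: k x => [|k IH] x; first exact: FG.
by near=> t; rewrite iterS /fdiff; apply: cvgB; near: t; exact: IH.
Unshelve. all: by end_near. Qed.

(** * Power series with geometrically bounded coefficients, and a mean value lemma *)

Lemma is_cvg_pseries_geometric (R : realType) (c : R^nat) (A B z : R) :
  0 <= B -> (forall n, `|c n| <= A * B ^+ n) -> B * `|z| < 1 ->
  cvgn (pseries c z).
Proof.
move=> B0 cAB Bz1.
have A0 : 0 <= A by have := le_trans (normr_ge0 _) (cAB 0%N); rewrite mulr1.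
apply: normed_cvg.
apply: (series_le_cvg _ (v_ := geometric A (B * `|z|))) => /=.
- by move=> n; exact: normr_ge0.
- by move=> n; rewrite mulr_ge0// exprn_ge0// mulr_ge0.
- by move=> n; rewrite normrM normrX exprMn mulrA ler_wpM2r// exprn_ge0.
- by apply: is_cvg_geometric_series; rewrite ger0_norm// mulr_ge0.
Qed.

(** The factor [n + 1] brought in by differentiation is at most [2 ^ n], so doubling the ratio
    absorbs it. *)
Lemma pseries_diffs_geometric (R : realType) (c : R^nat) (A B : R) :
  0 <= B -> (forall n, `|c n| <= A * B ^+ n) ->
  forall n, `|pseries_diffs c n| <= (A * B) * (2 * B) ^+ n.
Proof.
move=> B0 cAB n.
rewrite /pseries_diffs normrM normr_nat exprMn.
have -> : A * B * (2 ^+ n * B ^+ n) = 2 ^+ n * (A * B ^+ n.+1).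
  by rewrite exprS; ring.
by apply: ler_pM => //; rewrite -natrX ler_nat ltn_expl.
Qed.

(* Differentiating termwise twice, as [pseries_snd_diffs] requires, doubles the
   geometric ratio twice; hence the factor 8 > 4. *)
Lemma is_derive_pseries_geometric (R : realType) (c : R^nat) (A B z : R) :
  0 < B -> (forall n, `|c n| <= A * B ^+ n) -> 8 * B * `|z| < 1 ->
  is_derive z 1 (fun x => limn (pseries c x))
    (limn (pseries (pseries_diffs c) z)).
Proof.
move=> B0 cAB Bz.
have dAB := pseries_diffs_geometric (ltW B0) cAB.
have B20 : 0 <= 2 * B by rewrite mulr_ge0// ltW.
have ddAB := pseries_diffs_geometric B20 dAB.
have K0 : 0 < (8 * B)^-1 by rewrite invr_gt0 mulr_gt0.
have BK : B * (8 * B)^-1 = 8^-1 by rewrite invfM mulrCA divff ?gt_eqF// mulr1.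
apply: (@pseries_snd_diffs _ _ (8 * B)^-1).
- apply: (is_cvg_pseries_geometric (ltW B0) cAB).
  by rewrite (gtr0_norm K0) BK; lra.
- apply: (is_cvg_pseries_geometric _ dAB) => //.
  by rewrite (gtr0_norm K0) -mulrA BK; lra.
- apply: (is_cvg_pseries_geometric _ ddAB); first by rewrite mulr_ge0.
  by rewrite (gtr0_norm K0) -!mulrA BK; lra.
- by rewrite (gtr0_norm K0) -[X in _ < X]mul1r ltr_pdivlMr ?mulr_gt0// mulrC.
Qed.

(** The mean value theorem is applied to [s * z] for [s] in the unit interval, which treats both
    signs of [z] at once. *)
Lemma is_derive0_ball_cst (R : realType) (f : R -> R) (r z : R) :
  (forall x : R, `|x| < r -> is_derive x 1 f 0) -> `|z| < r -> f z = f 0.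
Proof.
move=> df zr.
have dh (s : R) : s \in `[0, 1] -> is_derive s 1 (f \o (fun s => s * z)) 0.
  rewrite in_itv/= => /andP[s0 s1].
  have dsz : is_derive (s * z) 1 f 0.
    apply: df; rewrite normrM (ger0_norm s0).
    by apply: le_lt_trans zr; rewrite ler_piMl.
  have ds : is_derive s 1 (fun s : R => s * z) z.
    have := @is_deriveM _ _ (@id R) (cst z) s 1 _ _
      (is_derive_id _ _) (is_derive_cst _ _ _).
    by rewrite scaler0 add0r /GRing.scale/= mulr1.
  by have := @is_derive1_comp _ f ( *%R^~ z) s _ _ dsz ds; rewrite mul0r.
set h := f \o _ in dh.
have ch : {within `[0, 1], continuous h}.
  by apply: derivable_within_continuous => s /dh[].
have dh' (s : R) : s \in `]0, 1[ -> is_derive s 1 h 0.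
  by move=> s01; apply: dh; exact: subset_itv_oo_cc s01.
have [s _] := MVT_segment ler01 dh' ch.
by rewrite /h/= mul1r !mul0r => /eqP; rewrite subr_eq0 => /eqP.
Qed.

(** * Generalised binomial coefficients and the binomial series *)

Definition binomial_coef (R : realType) (a : R) (n : nat) : R :=
  (\prod_(i < n) (a - i%:R)) / n`!%:R.

Lemma binomial_coefS (R : realType) (a : R) n :
  n.+1%:R * binomial_coef a n.+1 = (a - n%:R) * binomial_coef a n.
Proof.
rewrite /binomial_coef big_ord_recr/= factS natrM.
have f0 : (n`!%:R : R) != 0 by rewrite pnatr_eq0 -lt0n fact_gt0.
have : (n.+1%:R : R) != 0 by rewrite pnatr_eq0.
by move: (n.+1%:R : R) => m m0; field; rewrite m0 f0.
Qed.

(** The recurrence multiplies by [(a - n) / (n + 1)], and [|a - n| <= |a| + n <= (n + 1) (|a| + 1)].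
    The bound is crude, but any positive radius of convergence suffices. *)
Lemma binomial_coef_le (R : realType) (a : R) n :
  `|binomial_coef a n| <= (`|a| + 1) ^+ n.
Proof.
elim: n => [|n IH].
  by rewrite /binomial_coef big_ord0 fact0 divr1 normr1.
rewrite -(ler_pM2l (_ : 0 < n.+1%:R :> R)) ?ltr0Sn//.
rewrite -[X in X * `|_|](normr_nat R) -normrM binomial_coefS normrM.
rewrite exprS mulrA; apply: ler_pM => //.
apply: (le_trans (ler_normB _ _)); rewrite normr_nat mulrDr mulr1.
rewrite -natr1 mulrDl mul1r.
have : 0 <= n%:R * `|a| by rewrite mulr_ge0.
by lra.
Qed.

(* Both sides solve (1 + u) f' = a f with f 0 = 1. *)
Lemma binomial_series (R : realType) (a u : R) :
  8 * (`|a| + 1) * `|u| < 1 ->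
  pseries (binomial_coef a) u @ \oo --> (1 + u) `^ a.
Proof.
move=> u1; set c := binomial_coef a; set B := `|a| + 1.
have B1 : 1 <= B by rewrite lerDr.
have B0 : 0 < B by rewrite (lt_le_trans _ B1).
have c_le n : `|c n| <= 1 * B ^+ n by rewrite mul1r; exact: binomial_coef_le.
have small (v : R) : `|v| < (8 * B)^-1 -> 8 * B * `|v| < 1.
  by move=> vr; rewrite mulrC -ltr_pdivlMr ?mulr_gt0// div1r.
have cvg_c (v : R) : `|v| < (8 * B)^-1 -> cvgn (pseries c v).
  move=> /small vr; apply: (is_cvg_pseries_geometric (ltW B0) c_le).
  by apply: le_lt_trans vr; rewrite ler_wpM2r// ler_peMl// ?ltW//; lra.
have cvg_d (v : R) : `|v| < (8 * B)^-1 -> cvgn (pseries (pseries_diffs c) v).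
  move=> /small vr.
  apply: (is_cvg_pseries_geometric _ (pseries_diffs_geometric (ltW B0) c_le)).
    by rewrite mulr_ge0// ltW.
  by apply: le_lt_trans vr; rewrite ler_wpM2r// ler_wpM2r ?ltW//; lra.
have pos (v : R) : `|v| < (8 * B)^-1 -> 0 < 1 + v.
  move=> /small vr.
  have : `|v| < 1.
    by apply: le_lt_trans vr; rewrite ler_peMl//; lra.
  by rewrite ltr_norml; lra.
pose f (v : R) : R := limn (pseries c v).
pose f' (v : R) : R := limn (pseries (pseries_diffs c) v).
(* Coefficientwise, [(1 + v) f'] has [(n + 1) c_(n+1) + n c_n], which is [a c_n] by
   [binomial_coefS]. *)
have ode (v : R) : `|v| < (8 * B)^-1 -> (1 + v) * f' v = a * f v.
  move=> vr.
  have h1 := pseries_diffs_equiv (cvg_d _ vr).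
  rewrite -/(f' v) in h1.
  have h2 : a *: pseries c v @ \oo --> a * f v.
    by apply: cvgZl_tmp; exact: cvg_c.
  have h3 : pseries (pseries_diffs c) v +
    v *: series (fun i => i%:R * c i * v ^+ i.-1) @ \oo --> f' v + v * f' v.
    by apply: cvgD; [exact: cvg_d|exact: cvgZl_tmp].
  rewrite mulrDl mul1r -(cvg_lim (@norm_hausdorff _ _) h2).
  rewrite -(cvg_lim (@norm_hausdorff _ _) h3); congr (limn _).
  apply/funext => N; rewrite /pseries /series !fctE /GRing.scale/=.
  rewrite !mulr_sumr -big_split/=.
  apply: eq_bigr => i _; rewrite /pseries_diffs binomial_coefS -/c.
  by case: i => [|i]; rewrite /= ?exprS; ring.
(* In place of a uniqueness theorem for the differential equation, the quotient of the two solutions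
   is shown to have zero derivative, hence to be constant. *)
pose g v := f v * (1 + v) `^ (- a).
have dg (v : R) : `|v| < (8 * B)^-1 -> is_derive v 1 g 0.
  move=> vr.
  have df : is_derive v 1 f (f' v).
    exact: (is_derive_pseries_geometric B0 c_le (small _ vr)).
  have dp : is_derive v 1 (fun v => (1 + v) `^ (- a))
      (- a * (1 + v) `^ (- a - 1)).
    have d1 : is_derive v 1 (fun v : R => 1 + v) 1.
      have := @is_deriveD _ _ _ (cst (1 : R)) (@id R) v 1 _ _
        (is_derive_cst _ _ _) (is_derive_id _ _).
      by rewrite add0r.
    have := @is_derive1_comp _ (@powR R ^~ (- a)) (+%R 1) v _ _
      (is_derive1_powR (- a) (pos _ vr)) d1.
    by rewrite mulr1.
  have := is_deriveM df dp.
  rewrite /GRing.scale/=; congr is_derive.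
  (* One factor [1 + v] is split off the power so that [ode] applies to [(1 + v) * f' v]. *)
  rewrite -[X in X * f' v](_ : (1 + v) `^ (- a - 1) * (1 + v) = _); last first.
    rewrite -{2}[1 + v]powRr1 ?(ltW (pos _ vr))// -powRD ?subrK//.
    by rewrite (gt_eqF (pos _ vr)) implybT.
  by rewrite -mulrA ode//; ring.
have ur : `|u| < (8 * B)^-1.
  by rewrite -[X in _ < X]mul1r ltr_pdivlMr ?mulr_gt0// mulrC.
have g0 : g u = 1.
  rewrite (is_derive0_ball_cst dg ur) /g addr0 powR1 mulr1.
  apply/cvg_lim => //; apply: cvg_near_cst; exists 1%N => // N /= N1.
  rewrite /pseries /series/= big_ltn// big_nat_cond big1 ?addr0.
    by rewrite mulr1 /c /binomial_coef big_ord0 fact0 divr1.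
  by move=> [|i] //= _; rewrite expr0n mulr0.
have -> : (1 + u) `^ a = f u.
  have p0 := powR_gt0 (- a) (pos _ ur).
  apply: (mulIf (lt0r_neq0 p0)); rewrite -/(g u) g0 powRN divff//.
  by rewrite (gt_eqF (powR_gt0 a (pos _ ur))).
exact: cvg_c.
Qed.

(** * Uniqueness of power series coefficients *)

Lemma pseries_near0_eq0 (R : realType) (c : R^nat) :
  (\forall t \near (0 : R), pseries c t @ \oo --> (0 : R)) ->
  forall n, c n = 0.
Proof.
move=> /nbhs0P/nbhs_ballP[r /= r0 cr].
have {}cr t : `|t| < r -> pseries c t @ \oo --> (0 : R).
  move=> tr; have := cr t; rewrite add0r; apply.
  by rewrite /= -ball_normE /= sub0r normrN.
pose t0 := r / 2.
have t00 : 0 < t0 by rewrite divr_gt0.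
(* Convergence at [t0] bounds the terms [c n * t0 ^+ n], whence geometric growth of [c]. *)
have [A cA] : exists A, forall n, `|c n| <= A * t0^-1 ^+ n.
  have /cvgP/cvg_series_bounded[M [_ Mc]] : pseries c t0 @ \oo --> (0 : R).
    by apply: cr; rewrite gtr0_norm// /t0; lra.
  exists (M + 1) => n.
  have M1 : M < M + 1 by rewrite ltrDl.
  have := Mc (M + 1) M1 n Logic.I.
  rewrite /= normrM (gtr0_norm (exprn_gt0 n t00)) exprVn.
  by rewrite ler_pdivlMr ?exprn_gt0.
(* Once the earlier coefficients vanish, dividing by [t ^+ n] leaves the series of [e]. Its sum is 0
   for small nonzero [t], is continuous at 0, and takes the value [c n] there. *)
elim/ltn_ind => n IH.
pose e i := c (i + n)%N.
have eA i : `|e i| <= (A * t0^-1 ^+ n) * t0^-1 ^+ i.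
  by rewrite -mulrA -exprD addnC; exact: cA.
have e0 : limn (pseries e 0) = c n.
  apply/cvg_lim => //; apply: cvg_near_cst; exists 1%N => // N /= N1.
  rewrite /pseries /series/= big_ltn// big_nat_cond big1 ?addr0.
    by rewrite mulr1 /e add0n.
  by move=> [|i] //= _; rewrite expr0n mulr0.
have dfe : {for 0, continuous (fun t : R => limn (pseries e t))}.
  apply: differentiable_continuous; apply/derivable1_diffP.
  have := @is_derive_pseries_geometric _ e _ t0^-1 0 _ eA.
  by rewrite normr0 mulr0 invr_gt0 => /(_ t00 ltr01)[].
rewrite -e0.
apply: (@cvg_unique _ _ ((fun t : R => limn (pseries e t)) @ 0^')) => //.
  by apply: cvg_trans dfe; apply: cvg_app; exact: cvg_within.
apply: cvg_near_cst; near=> t.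
have tn0 : t != 0 by near: t; exact: nbhs_dnbhs_neq.
have tr : `|t| < r by near: t; apply: dnbhs0_lt.
have ce N : pseries e t N = (t ^+ n)^-1 * pseries c t (N + n)%N.
  rewrite /pseries /series/= addnC (big_cat_nat _ (leq_addr N n))//=.
  rewrite [X in _ * (X + _)]big_nat_cond [X in _ * (X + _)]big1 ?add0r;
    last first.
    by move=> i; rewrite andbT => /= /IH ->; rewrite mul0r.
  rewrite -{2}[n]add0n big_addn addKn mulr_sumr; apply: eq_bigr => i _.
  by rewrite /e exprD; field; rewrite expf_neq0.
have : (fun N => (t ^+ n)^-1 * pseries c t (N + n)%N) @ \oo --> (t ^+ n)^-1 * 0.
  by apply: cvgMl_tmp; rewrite cvg_shiftn; exact: cr.
by rewrite mulr0 -(funext ce) => /cvg_lim; apply.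
Unshelve. all: by end_near. Qed.

Lemma dstirling2_expansion_unique (R : realType) (lambda x : R) k
    (a b : nat -> R) :
  dstirling2_expansion lambda k x a -> dstirling2_expansion lambda k x b ->
  forall n, (k <= n)%N -> a n = b n.
Proof.
move=> ea eb n kn.
(* An expansion leaves the coefficients below [k] unconstrained, hence the padding by zero. *)
pose c i := if (k <= i)%N then (a i - b i) / i`!%:R else 0.
have /(_ n) : forall i, c i = 0.
  apply: pseries_near0_eq0; near=> t.
  have at_ : (fun N => \sum_(k <= i < N) a i * (t ^+ i / i`!%:R)) @ \oo
      --> dstirling2_gf lambda k x t by near: t; exact: ea.
  have bt : (fun N => \sum_(k <= i < N) b i * (t ^+ i / i`!%:R)) @ \oo
      --> dstirling2_gf lambda k x t by near: t; exact: eb.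
  rewrite -[X in _ --> X](subrr (dstirling2_gf lambda k x t)).
  suff -> : pseries c t = (fun N => \sum_(k <= i < N) a i * (t ^+ i / i`!%:R)) -
      (fun N => \sum_(k <= i < N) b i * (t ^+ i / i`!%:R)) by exact: cvgB.
  apply/funext => N; rewrite !fctE -sumrB /pseries /series/=.
  rewrite [RHS](big_nat_widenl _ 0)//= [RHS]big_mkcond/=.
  by apply: eq_bigr => i _; rewrite /c; case: leqP => _; rewrite ?mul0r//; ring.
rewrite /c kn => /eqP; rewrite mulf_eq0 invr_eq0 pnatr_eq0 gtn_eqF ?fact_gt0//.
by rewrite orbF subr_eq0 => /eqP.
Unshelve. all: by end_near. Qed.

(** * Degenerate falling factorials and their generating function *)

Definition dfalling (R : realType) (lambda : R) (n : nat) (y : R) : R :=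
  \prod_(i < n) (y - i%:R * lambda).

Lemma dfallingE (R : realType) (lambda y : R) n : lambda != 0 ->
  dfalling lambda n y = lambda ^+ n * \prod_(i < n) (y / lambda - i%:R).
Proof.
move=> l0; rewrite -[X in _ ^+ X]card_ord -prodr_const -big_split/=.
by apply: eq_bigr => i _; field.
Qed.

Lemma dfalling_stirling1 (R : realType) (lambda : R) n : lambda != 0 ->
  dfalling lambda n = fun y =>
    \sum_(0 <= m < n.+1) lambda ^+ (n - m) * (stirling1 n m)%:~R * y ^+ m.
Proof.
move=> l0; apply/funext => y; rewrite dfallingE//.
have sz : size (falling_poly n) = n.+1.
  by rewrite /falling_poly size_prod_XsubC -[index_enum _]enumT size_enum_ord.
have -> : \prod_(i < n) (y / lambda - i%:R) =
    (map_poly (intr : int -> R) (falling_poly n)).[y / lambda].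
  rewrite /falling_poly rmorph_prod horner_prod; apply: eq_bigr => i _ /=.
  by rewrite rmorphB/= map_polyX map_polyC/= hornerXsubC.
rewrite (@horner_coef_wide _ n.+1) ?(leq_trans (size_poly _ _)) ?sz//.
rewrite mulr_sumr big_mkord; apply: eq_bigr => i _.
rewrite coef_map/= /stirling1 expr_div_n.
(* As [i <= n], the truncated [n - i] is a true difference, and [lambda ^+ n] splits accordingly. *)
have /(subnK) {1}<- : (i <= n)%N by rewrite -ltnS.
by rewrite exprD; field; rewrite expf_neq0.
Qed.

Lemma iter_fdiff_dfalling (R : realType) (lambda x : R) k n : lambda != 0 ->
  iter k (@fdiff R) (dfalling lambda n) x =
  \sum_(0 <= m < n.+1) lambda ^+ (n - m) * (stirling1 n m)%:~R *
    iter k (@fdiff R) (fun y => y ^+ m) x.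
Proof. by move=> l0; rewrite dfalling_stirling1// iter_fdiff_sum. Qed.

Lemma iter_fdiff_dfalling_eq0 (R : realType) (lambda x : R) k n :
  lambda != 0 -> (n < k)%N -> iter k (@fdiff R) (dfalling lambda n) x = 0.
Proof.
move=> l0 nk; rewrite iter_fdiff_dfalling// big_nat_cond big1// => m.
rewrite andbT => /andP[_ mn].
by rewrite iter_fdiff_exp_eq0 ?mulr0// (leq_trans mn).
Qed.

Lemma dfalling_series (R : realType) (lambda y : R) : lambda != 0 ->
  \forall t \near (0 : R),
    (fun N => \sum_(0 <= n < N) (t ^+ n / n`!%:R) * dfalling lambda n y) @ \oo
    --> (1 + lambda * t) `^ (y / lambda).
Proof.
move=> l0.
(* The product of this constant with [|t|] must stay below 1 for [binomial_series] to apply at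
   [lambda * t]. *)
have K0 : 0 < 8 * (`|y / lambda| + 1) * `|lambda|.
  by rewrite !mulr_gt0 ?normr_gt0// ltr_wpDl.
near=> t.
have -> : (fun N => \sum_(0 <= n < N) (t ^+ n / n`!%:R) * dfalling lambda n y) =
    pseries (binomial_coef (y / lambda)) (lambda * t).
  apply/funext => N; apply: eq_bigr => i _.
  by rewrite dfallingE//= /binomial_coef exprMn; ring.
apply: binomial_series; rewrite [`|lambda * t|]normrM mulrA mulrC.
rewrite -ltr_pdivlMr//.
by near: t; apply: (@nbhs0_lt _ R); rewrite divr_gt0.
Unshelve. all: by end_near. Qed.

(** Differences in [y] are applied to the partial sums of [dfalling_series] before passing to the
    limit. This also provides the existence of an expansion, without which [dstirling2] would be a
    default value. *)
Lemma dstirling2_expansion_fdiff (R : realType) (lambda x : R) k :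
  lambda != 0 ->
  dstirling2_expansion lambda k x (fun n =>
    (k`!%:R)^-1 * iter k (@fdiff R) (dfalling lambda n) x).
Proof.
move=> l0; near=> t.
have t0 : 0 < 1 + lambda * t.
  have : `|lambda * t| < 1.
    rewrite normrM mulrC -ltr_pdivlMr ?normr_gt0//.
    by near: t; apply: (@nbhs0_lt _ R); rewrite divr_gt0 ?normr_gt0.
  by rewrite ltr_norml; lra.
have cvg_fdiff : (fun N => iter k (@fdiff R)
      (fun y => \sum_(0 <= n < N) (t ^+ n / n`!%:R) * dfalling lambda n y) x)
    @ \oo --> iter k (@fdiff R) (fun y => (1 + lambda * t) `^ (y / lambda)) x.
  near: t.
  exact: (@cvg_iter_fdiff _
    (fun t N y => \sum_(0 <= n < N) (t ^+ n / n`!%:R) * dfalling lambda n y)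
    (fun t y => (1 + lambda * t) `^ (y / lambda)) k x
    (fun y => dfalling_series y l0)).
rewrite iter_fdiff_powR// in cvg_fdiff.
rewrite /dstirling2_gf -mulrA.
rewrite (_ : (fun N => _) = fun N => (k`!%:R)^-1 * iter k (@fdiff R)
    (fun y => \sum_(0 <= n < N) (t ^+ n / n`!%:R) * dfalling lambda n y) x).
  exact: cvgMl_tmp.
apply/funext => N; rewrite iter_fdiff_sum mulr_sumr.
(* The sum is extended below [k] by terms that vanish for degree reasons. *)
rewrite [LHS](big_nat_widenl _ 0)//= [LHS]big_mkcond/=.
apply: eq_bigr => n _; case: leqP => [_|nk]; first by ring.
by rewrite iter_fdiff_dfalling_eq0 ?mulr0.
Unshelve. all: by end_near. Qed.

Theorem theorem2 (R : realType) (lambda : R) (hlambda : lambda != 0) (x : R)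
    (n k : nat) :
  \sum_(0 <= m < n.+1)
     (k`!%:R)^-1 * iter k (@fdiff R) (fun y : R => y ^+ m) x *
     lambda ^+ (n - m) * (stirling1 n m)%:~R
  = if (k <= n)%N then dstirling2 lambda n k x else 0.
Proof.
transitivity ((k`!%:R)^-1 * iter k (@fdiff R) (dfalling lambda n) x).
  by rewrite iter_fdiff_dfalling// mulr_sumr; apply: eq_bigr => m _; ring.
case: leqP => [kn|nk]; last by rewrite iter_fdiff_dfalling_eq0 ?mulr0.
have ex := dstirling2_expansion_fdiff x k hlambda.
(* Since an expansion exists, [xgetI] makes the chosen sequence one as well, and the two agree from
   index [k] on. *)
exact: (dstirling2_expansion_unique ex (xgetI _ ex) kn).
Qed.
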